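(* Let $P$ be a sober Scott space with only countably many Scott open sets. Then $\sigma P$, the lattice of Scott open subsets of $P$ ordered by inclusion, is an algebraic lattice.
   Context: A dcpo is a poset in which every directed subset has a supremum. An upper subset $O$ of a poset $P$ is Scott open if for every directed $D\subseteq P$ whose supremum exists and lies in $O$ one has $D\cap O\neq\emptyset$. The Scott open sets form the Scott topology $\sigma P$. A Scott space is a dcpo equipped with the Scott topology. A space is sober if every irreducible closed subset is the closure of a unique singleton. In a poset, $x\ll y$ means that for every directed set $D$ whose supremum exists, $y\leq\sup D$ implies $x\leq d$ for some $d\in D$; a poset is algebraic if for each $y$ the set $\{x\mid x\ll x\leq y\}$ is directed with supremum $y$. An algebraic lattice is a complete lattice that is algebraic. *)

(* Defs.v *)
From HB Require Import structures.
From mathcomp Require Import all_boot all_order.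
From mathcomp Require Import boolp classical_sets cardinality topology_structure.

Set Implicit Arguments.
Unset Strict Implicit.
Unset Printing Implicit Defensive.

Local Open Scope classical_set_scope.
Local Open Scope order_scope.

Section poset_notions.
Context {d : Order.disp_t} {P : porderType d}.
Implicit Types (x y z : P) (A D O : set P).

Definition directed D : Prop :=
  D !=set0 /\ forall x y, D x -> D y -> exists z, [/\ D z, x <= z & y <= z].

Definition upper O : Prop := forall x y, O x -> x <= y -> O y.

(* [supremums D s] reads: the supremum of [D] exists and equals [s]. *)
Definition scott_open : set (set P) := [set O | upper O /\
  forall D s, directed D -> supremums D s -> O s -> D `&` O !=set0].

Definition way_below x y : Prop :=
  forall D s, directed D -> supremums D s -> y <= s ->
    exists2 z, D z & x <= z.

End poset_notions.

Definition dcpo {d} (P : porderType d) : Prop :=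
  forall D : set P, directed D -> supremums D !=set0.

Definition algebraic_poset {d} (P : porderType d) : Prop :=
  forall y : P, let K := [set x | way_below x x /\ x <= y] in
    directed K /\ supremums K y.

Definition complete_lattice {d} (P : porderType d) : Prop :=
  forall A : set P, supremums A !=set0 /\ infimums A !=set0.

Definition algebraic_lattice {d} (P : porderType d) : Prop :=
  complete_lattice P /\ algebraic_poset P.

Definition irreducible {X : topologicalType} (C : set X) : Prop :=
  C !=set0 /\ forall A B : set X, closed A -> closed B ->
    C `<=` A `|` B -> C `<=` A \/ C `<=` B.

Definition sober (X : topologicalType) : Prop :=
  forall C : set X, closed C -> irreducible C ->
    exists! x, C = closure [set x].

(* Type alias, so that the Scott topology does not compete with another
   topology that [P] may carry. *)
Definition scott {d} (P : porderType d) : Type := P.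

HB.instance Definition _ d (P : porderType d) := Choice.on (scott P).

Section scott_topology.
Context {d : Order.disp_t} (P : porderType d).

Lemma scott_openT : scott_open [set: P].
Proof. by split=> // D s [[x Dx] _] _ _; exists x. Qed.

Lemma scott_openI : setI_closed (@scott_open d P).
Proof.
move=> A B [upA sA] [upB sB]; split.
  by move=> x y [Ax Bx] xy; split; [exact: upA xy|exact: upB xy].
move=> D s dirD Ds [As Bs].
have [a [Da Aa]] := sA D s dirD Ds As; have [b [Db Bb]] := sB D s dirD Ds Bs.
have [c [Dc ac bc]] := dirD.2 a b Da Db.
by exists c; split=> //; split; [exact: upA ac|exact: upB bc].
Qed.

Lemma scott_open_bigcup (I : Type) (f : I -> set P) :
  (forall i, scott_open (f i)) -> scott_open (\bigcup_i f i).
Proof.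
move=> fo; split=> [x y [i _ fx] xy|D s dirD Ds [i _ fs]].
  by exists i => //; exact: (fo i).1 xy.
by have [x [Dx fx]] := (fo i).2 D s dirD Ds fs; exists x; split=> //; exists i.
Qed.

HB.instance Definition _ := isOpenTopological.Build (scott P)
  scott_openT scott_openI scott_open_bigcup.

Lemma scott_openE : @open (scott P) = @scott_open d P.
Proof. by []. Qed.

End scott_topology.

Definition sigma {d} (P : porderType d) : Type := set_type (@scott_open d P).

HB.instance Definition _ d (P : porderType d) := SubChoice.on (sigma P).
HB.instance Definition _ d (P : porderType d) :=
  [SubChoice_isSubPOrder of sigma P by <: with set_display].

Lemma sigma_leE {d} (P : porderType d) (U V : sigma P) :
  (U <= V)%O = `[< val U `<=` val V >].
Proof. by []. Qed.

(* Main.v *)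
Require Import Defs.
From HB Require Import structures.
From mathcomp Require Import all_boot all_order.
From mathcomp Require Import boolp classical_sets cardinality topology_structure.

(** The proof shows that the Scott open sets of the form [up F], with [F]
    finite, form a base; such sets are compact elements of the lattice of open
    sets, which is therefore algebraic.

    Quasicontinuity ([finitary_neighbourhood]).  A poset with countably many
    Scott open sets is itself countable, since [x] can be read off from the
    open complement of its down-set.  Let [x] lie in an open set [U], and
    suppose that no [up F] with [F] a finite part of [U] is a neighbourhood of
    [x].  Going through the points of [U] and the open neighbourhoods of [x]
    one by one gives a sequence [a] that converges to [x] while each point of
    [U] lies below only finitely many [a n].  A directed set whose supremum is
    in [U] has an element [p] in [U], so only finitely many [a n] matter above
    [p]; hence deleting from [U] the down-sets of a tail of [a] leaves a Scott
    open set ([scott_open_avoid]).  A late enough tail leaves [x] in this set,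
    which contradicts the convergence of [a] to [x].

    From quasicontinuity to algebraicity ([finitary_between]).  Write [V] inside
    [W] when a set [up F] with [F] finite lies between them.  By the first part
    this relation interpolates.  If no open set [K] with [K] inside [K] lay
    between [V] and [U], interpolation would always be strict, and one could
    shrink nested intervals of open sets so as to avoid the open sets of a
    given enumeration one after the other, as in Cantor's proof that the reals
    are uncountable; the union of the lower ends would be an open set missing
    from the enumeration. *)

Set Implicit Arguments.
Unset Strict Implicit.
Unset Printing Implicit Defensive.

Import Order.TTheory.

Local Open Scope classical_set_scope.
Local Open Scope order_scope.

(** * Scott open sets of a poset *)

Section poset.
Context {d : Order.disp_t} {P : porderType d}.
Implicit Types (x y z : P) (U V W O D : set P) (F : seq P).

Definition up F : set P := [set y | exists2 z, z \in F & z <= y].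

Definition not_below x : set P := [set y | ~ y <= x].

Lemma scott_open_not_below x : scott_open (not_below x).
Proof.
split=> [y z yNx yz zx|D s _ [_ leastDs] sNx]; first exact/yNx/(le_trans yz).
have [[y [Dy yNx]]|none] := pselect (exists y, D y /\ ~ y <= x).
  by exists y.
exfalso; apply: sNx; apply: leastDs => y Dy.
by have [//|yNx] := pselect (y <= x); case: none; exists y.
Qed.

Lemma not_below_inj : injective not_below.
Proof.
move=> x y exy; apply: le_anti; apply/andP; split.
  apply: contrapT => xNy; have : not_below x x by rewrite exy.
  by apply.
apply: contrapT => yNx; have : not_below y y by rewrite -exy.
by apply.
Qed.

Lemma sub_up F U : upper U -> (forall z, z \in F -> U z) -> up F `<=` U.
Proof. by move=> upU FU y [z zF zy]; exact: upU (FU z zF) zy. Qed.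

(** Each [a n] with [N <= n] fails to bound [D], so some element of [D] is not
    below it; directedness deals with finitely many [n] at once. *)
Lemma directed_avoid D (a : nat -> P) (p s : P) (N j : nat) :
  directed D -> supremums D s -> D p ->
  (forall n, (N <= n)%N -> ~ s <= a n) ->
  exists e, [/\ D e, p <= e & forall n, (N <= n < j)%N -> ~ e <= a n].
Proof.
move=> dirD [_ leastDs] Dp sNa.
elim: j => [|j [e [De pe eNa]]].
  by exists p; split=> // n; rewrite ltn0 andbF.
have [Nj|jN] := leqP N j; last first.
  exists e; split=> // n /andP[Nn nj].
  by move: (leq_trans jN Nn); rewrite ltnNge -ltnS nj.
have [f Df fNa] : exists2 f, D f & ~ f <= a j.
  apply: contrapT => none; apply: (sNa j Nj); apply: leastDs => f Df.
  by apply: contrapT => fNa; apply: none; exists f.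
have [g [Dg eg fg]] := dirD.2 e f De Df.
exists g; split=> // [|n]; first exact: le_trans eg.
rewrite ltnS [(n <= j)%N]leq_eqVlt andb_orr => /orP[/andP[_ /eqP->] ga|Nnj ga].
  exact/fNa/(le_trans fg).
exact/(eNa n Nnj)/(le_trans eg).
Qed.

(** The union of the down-sets of a sequence is in general not Scott closed.
    Inside [U] it is as soon as the sequence is locally finite in the order:
    above a given point of [U], only finitely many of the down-sets count. *)
Lemma scott_open_avoid U (a : nat -> P) (N : nat) :
  scott_open U ->
  (forall p, U p -> exists j, forall n, (j <= n)%N -> ~ p <= a n) ->
  scott_open (U `&` [set y | forall n, (N <= n)%N -> ~ y <= a n]).
Proof.
move=> [upU oU] fin; split=> [y z [Uy yNa] yz|D s dirD Ds [Us sNa]].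
  split; first exact: upU yz.
  by move=> n Nn za; exact/(yNa n Nn)/(le_trans yz).
have [p [Dp Up]] := oU D s dirD Ds Us.
have [j pNa] := fin p Up.
have [e [De pe eNa]] := directed_avoid j dirD Ds Dp sNa.
exists e; split=> //; split; first exact: upU pe.
move=> n Nn ea; have [jn|nj] := leqP j n.
  exact/(pNa n jn)/(le_trans pe).
by apply: (eNa n _ ea); rewrite Nn nj.
Qed.

Lemma scott_open_bigcup_in (I : Type) (A : set I) (f : I -> set P) :
  (forall i, A i -> scott_open (f i)) -> scott_open (\bigcup_(i in A) f i).
Proof.
move=> fo; split=> [x y [i Ai fx] xy|D s dirD Ds [i Ai fs]].
  by exists i => //; exact: (fo i Ai).1 xy.
have [x [Dx fx]] := (fo i Ai).2 D s dirD Ds fs.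
by exists x; split=> //; exists i.
Qed.

(** * Quasicontinuity *)

(** An open set is inside itself exactly when it is [up F] for a finite [F].
    Between open sets of a quasicontinuous poset this is the way-below
    relation, with a finite witness. *)
Definition inside V W : Prop := exists2 F, V `<=` up F & up F `<=` W.

Lemma inside_sub V W : inside V W -> V `<=` W.
Proof. by move=> [F VF FW]; exact: subset_trans FW. Qed.

Section countably_many_open_sets.
Hypothesis P_countable : countable (@scott_open d P).

Lemma scott_open_enum :
  exists G : nat -> set P, forall O, scott_open O -> exists n, G n = O.
Proof.
have /countable_injP[f] := P_countable => f_inj.
exists (fun n => xget set0 [set O | scott_open O /\ f O = n]) => O oO.
exists (f O); case: xgetP => [O' _ [oO' ffO]|none].
  by apply: f_inj; rewrite ?inE.
by case: (none O).
Qed.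

(** Points are coded by the open complements of their down-sets, so an
    enumeration of the open sets also enumerates the points. *)
Lemma point_enum (x0 : P) : exists u : nat -> P, forall x, exists n, u n = x.
Proof.
have [G Gsurj] := scott_open_enum.
exists (fun n => xget x0 [set x | G n = not_below x]) => x.
have [n Gn] := Gsurj _ (scott_open_not_below x); exists n.
case: xgetP => [y _ /=|none]; last by case: (none x).
by rewrite Gn => /not_below_inj.
Qed.

Lemma common_neighbourhood (G : nat -> set P) x (n : nat) :
  exists V, [/\ scott_open V, V x &
    forall i, (i < n)%N -> scott_open (G i) -> G i x -> V `<=` G i].
Proof.
elim: n => [|n [V [oV Vx VG]]].
  by exists setT; split=> //; exact: scott_openT.
have [[oG Gx]|GN] := pselect (scott_open (G n) /\ G n x).
  exists (V `&` G n); split=> //; first exact: scott_openI.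
  move=> i; rewrite ltnS leq_eqVlt => /orP[/eqP-> _ _ y []//|lin oGi Gix y [Vy _]].
  exact: (VG i lin oGi Gix y Vy).
exists V; split=> // i; rewrite ltnS leq_eqVlt => /orP[/eqP-> oG Gx|].
  by case: GN.
exact: VG.
Qed.

(** Otherwise one picks [a n] in a neighbourhood of [x] that lies in each of
    the first [n] open neighbourhoods of [x], but above none of the first [n]
    points of [U]. The open set of [scott_open_avoid] then contains [x] but no
    late [a n]. *)
Lemma finitary_neighbourhood U x :
  scott_open U -> U x -> exists V, [/\ scott_open V, V x & inside V U].
Proof.
move=> oU Ux; apply: contrapT => none.
have [G Gsurj] := scott_open_enum; have [u usurj] := point_enum x.
have /choice[a aP] : forall n, exists a,
    (forall i, (i <= n)%N -> scott_open (G i) -> G i x -> G i a) /\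
    (forall i, (i <= n)%N -> U (u i) -> ~ u i <= a).
  move=> n; have [V [oV Vx VG]] := common_neighbourhood G x n.+1.
  pose F := [seq u i | i <- iota 0 n.+1 & `[< U (u i) >]].
  have FU : up F `<=` U.
    apply: sub_up oU.1 _ => z /mapP[i].
    by rewrite mem_filter => /andP[/asboolP Uui _] ->.
  have [b Vb bNF] : exists2 b, V b & ~ up F b.
    apply: contrapT => VF; apply: none; exists V; split=> //; exists F => // b Vb.
    by apply: contrapT => bNF; apply: VF; exists b.
  exists b; split=> [i lin oG Gx|i lin Uui uib]; first exact: VG Vb.
  apply: bNF; exists (u i) => //; apply: map_f.
  by rewrite mem_filter mem_iota /= add0n ltnS lin andbT; apply/asboolP.
have fin p : U p -> exists j, forall n, (j <= n)%N -> ~ p <= a n.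
  by have [j <-] := usurj p => Up; exists j => n jn; exact: (aP n).2 jn Up.
have [N xNa] := fin x Ux.
have oO := scott_open_avoid N oU fin.
have [k Gk] := Gsurj _ oO.
(* Beyond index [k] the sequence stays in the neighbourhood [G k] of [x], and
   beyond [N] this neighbourhood was built so as to avoid it. *)
have : G k (a (maxn k N)).
  apply: (aP _).1; rewrite ?leq_maxl ?Gk //; split=> //; exact: xNa.
by rewrite Gk => -[_ /(_ _ (leq_maxr k N))]; apply.
Qed.

(** * Compact open sets *)

(** The union of the finitely many neighbourhoods that [finitary_neighbourhood]
    provides at the points of [F]. *)
Lemma finitary_hull F U : scott_open U -> (forall z, z \in F -> U z) ->
  exists W, [/\ scott_open W, up F `<=` W & inside W U].
Proof.
move=> oU; elim: F => [|z F IHF] FU.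
  exists set0; split=> //; last by exists [::] => // y [].
  - by split=> // D s _ _ [].
  - by move=> y [].
have [|W [oW FW [F1 WF1 F1U]]] := IHF.
  by move=> y yF; apply: FU; rewrite inE yF orbT.
have [|V [oV Vz [F2 VF2 F2U]]] := @finitary_neighbourhood U z oU.
  by apply: FU; rewrite inE eqxx.
exists (\bigcup_(O in [set V; W]) O); split.
- by apply: scott_open_bigcup_in => O [->|->].
- move=> y [t]; rewrite inE => /orP[/eqP->|tF] ty.
    by exists V; [left|exact: oV.1 ty].
  by exists W; [right|apply: FW; exists t].
- exists (F2 ++ F1) => y.
    by move=> [O [->|->]] => [/VF2|/WF1] [t tF ty];
      exists t => //; rewrite mem_cat tF ?orbT.
  by move=> [t]; rewrite mem_cat => /orP[tF|tF] ty;
    [apply: F2U|apply: F1U]; exists t.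
Qed.

Lemma inside_interpolate V U : scott_open U -> inside V U ->
  exists W, [/\ scott_open W, inside V W & inside W U].
Proof.
move=> oU [F VF FU].
have [|W [oW FW WU]] := @finitary_hull F U oU.
  by move=> z zF; apply: FU; exists z.
by exists W; split=> //; exists F.
Qed.

Definition compact_free (I : set P * set P) : Prop :=
  [/\ scott_open I.1, scott_open I.2, inside I.1 I.2 &
   forall K, scott_open K -> I.1 `<=` K -> K `<=` I.2 -> ~ inside K K].

(** One step of the diagonal argument: two interpolants [A] inside [B] are
    distinct in a compact-free interval, so [H] fails to contain [B] or fails
    to be contained in [A]. *)
Lemma compact_free_shrink (H : set P) I : compact_free I ->
  exists J, [/\ compact_free J, I.1 `<=` J.1, J.2 `<=` I.2 &
              ~ (J.1 `<=` H /\ H `<=` J.2)].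
Proof.
case: I => V U [/= oV oU VU noK].
have [B [oB VB BU]] := inside_interpolate oU VU.
have [A [oA VA AB]] := inside_interpolate oB VB.
have [sVA sAB sBU] := And3 (inside_sub VA) (inside_sub AB) (inside_sub BU).
have sAU := subset_trans sAB sBU; have sVB := subset_trans sVA sAB.
have [BH|BNH] := pselect (B `<=` H); last first.
  exists (B, U); split=> //=; last by case.
  by split=> //= K oK /(subset_trans sVB); exact: noK.
exists (V, A); split=> //=.
  by split=> //= K oK VK /subset_trans/(_ sAU); exact: noK.
move=> [_ HA]; apply: (noK A oA sVA sAU).
have eAB : B = A by apply/seteqP; split=> //; exact: subset_trans HA.
by move: AB; rewrite eAB.
Qed.

Lemma finitary_between V U : scott_open V -> scott_open U -> inside V U ->
  exists K, [/\ scott_open K, V `<=` K, K `<=` U & inside K K].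
Proof.
move=> oV oU VU; apply: contrapT => none.
have freeVU : compact_free (V, U).
  by split=> //= K oK VK KU KK; apply: none; exists K.
have [G Gsurj] := scott_open_enum.
pose T := {I | compact_free I}.
have /choice[next nextP] (nI : nat * T) : exists J : T,
    [/\ (sval nI.2).1 `<=` (sval J).1, (sval J).2 `<=` (sval nI.2).2 &
        ~ ((sval J).1 `<=` G nI.1 /\ G nI.1 `<=` (sval J).2)].
  have [J [freeJ ? ? ?]] := compact_free_shrink (G nI.1) (svalP nI.2).
  by exists (exist _ J freeJ).
(* The pair [I n.+1] is chosen so that [G n] does not lie between its ends. *)
pose I := fix I n : T := if n is m.+1 then next (m, I m) else exist _ _ freeVU.
pose L n := (sval (I n)).1; pose R n := (sval (I n)).2.
have Lmono m n : (m <= n)%N -> L m `<=` L n.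
  move=> /subnKC <-; elim: (n - m)%N => [|k IHk]; rewrite ?addn0// addnS.
  by apply: subset_trans IHk _; case: (nextP ((m + k)%N, I (m + k)%N)).
have Rmono m n : (m <= n)%N -> R n `<=` R m.
  move=> /subnKC <-; elim: (n - m)%N => [|k IHk]; rewrite ?addn0// addnS.
  by apply: subset_trans IHk; case: (nextP ((m + k)%N, I (m + k)%N)).
have LR n : L n `<=` R n by case: (svalP (I n)) => _ _ /inside_sub.
have [n Gn] : exists n, G n = \bigcup_m L m.
  by apply/Gsurj/scott_open_bigcup => m; case: (svalP (I m)).
case: (nextP (n, I n)) => _ _; apply; rewrite /= Gn; split.
  by move=> y Ly; exists n.+1.
move=> y [m _ Ly]; apply: (Rmono n.+1 _ (leq_maxr m _)).
exact/LR/(Lmono m _ (leq_maxl _ _)).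
Qed.

Lemma finitary_basis U x : scott_open U -> U x ->
  exists K, [/\ scott_open K, K x, K `<=` U & inside K K].
Proof.
move=> oU Ux; have [V [oV Vx VU]] := finitary_neighbourhood oU Ux.
have [K [oK VK KU KK]] := finitary_between oV oU VU.
by exists K; split=> //; exact: VK.
Qed.

End countably_many_open_sets.
End poset.

(** * The lattice of Scott open sets *)

Section lattice.
Context {d : Order.disp_t} {P : porderType d}.
Implicit Types (A D : set (sigma P)) (U V S : sigma P).

Lemma sigma_leP U V : (U <= V) <-> (val U `<=` val V).
Proof. by rewrite sigma_leE; split=> /asboolP. Qed.

Lemma sigma_open U : scott_open (val U).
Proof. exact: set_valP. Qed.

Lemma sigma_witness (O : set P) : scott_open O -> exists U, val U = O.
Proof. by move=> oO; exists (SigSub (mem_set oO)). Qed.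

Lemma supremums_bigcup A S :
  val S = \bigcup_(U in A) val U -> supremums A S.
Proof.
move=> eS; split=> [U AU|V ubV]; apply/sigma_leP; rewrite eS.
  by move=> x Ux; exists U.
by move=> x [U AU]; have /sigma_leP := ubV U AU; apply.
Qed.

Lemma sigma_bigcup A : exists S, val S = \bigcup_(U in A) val U.
Proof. by apply/sigma_witness/scott_open_bigcup_in => U _; exact: sigma_open. Qed.

Lemma supremums_sub A S : supremums A S -> val S `<=` \bigcup_(U in A) val U.
Proof.
move=> [_ least]; have [S' eS'] := sigma_bigcup A.
by rewrite -eS'; apply/sigma_leP/least; case: (supremums_bigcup eS').
Qed.

Lemma sigma_complete : complete_lattice (sigma P).
Proof.
move=> A; split.
  by have [S /supremums_bigcup] := sigma_bigcup A; exists S.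
have [S /supremums_bigcup[ubS leastS]] := sigma_bigcup (lbound A).
exists S; split; last exact: ubS.
by move=> U AU; apply: leastS => V; apply.
Qed.

(** Each of the finitely many generators of [U] lies in a member of [D], and
    directedness puts all of them in a single member, which contains [U]. *)
Lemma inside_compact U : inside (val U) (val U) -> way_below U U.
Proof.
move=> [F UF FU] D S [[V0 DV0] dirD] DS /sigma_leP US.
suff [V DV FV] : exists2 V, D V & forall z, z \in F -> val V z.
  exists V => //; apply/sigma_leP; apply: subset_trans UF _.
  exact: sub_up (sigma_open V).1 FV.
have {UF FU US} : forall z, z \in F -> exists2 V, D V & val V z.
  by move=> z zF; apply/(supremums_sub DS)/US/FU; exists z.
elim: F => [_|z F IHF FD]; first by exists V0.
have [V DV FV] : exists2 V, D V & forall z, z \in F -> val V z.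
  by apply: IHF => y yF; apply: FD; rewrite inE yF orbT.
have [V' DV' V'z] : exists2 V, D V & val V z.
  by apply: FD; rewrite inE eqxx.
have [W [DW /sigma_leP VW /sigma_leP V'W]] := dirD V V' DV DV'.
exists W => // y; rewrite inE => /orP[/eqP->|yF]; first exact: V'W.
exact/VW/FV.
Qed.

Lemma directed_compact_below U : directed [set V | way_below V V /\ V <= U].
Proof.
split.
  have [V eV] := sigma_bigcup set0; rewrite bigcup_set0 in eV.
  exists V; split; last by apply/sigma_leP; rewrite eV.
  by move=> D S [[W DW] _] _ _; exists W => //; apply/sigma_leP; rewrite eV.
move=> V W [cV VU] [cW WU].
have [S /supremums_bigcup[ubS leastS]] := sigma_bigcup [set V; W].
have VS : V <= S by apply: ubS; left.
have WS : W <= S by apply: ubS; right.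
exists S; split=> //; split; last by apply: leastS => O [->|->].
move=> D s dirD Ds Ss.
have [X DX VX] := cV D s dirD Ds (le_trans VS Ss).
have [Y DY WY] := cW D s dirD Ds (le_trans WS Ss).
have [Z [DZ XZ YZ]] := dirD.2 X Y DX DY.
exists Z => //; apply: leastS => O [->|->].
  exact: le_trans XZ.
exact: le_trans YZ.
Qed.

End lattice.

Theorem proposition4p2 (d : Order.disp_t) (P : porderType d)
    (P_dcpo : dcpo P) (P_sober : sober (scott P))
    (P_countable : countable (@scott_open d P)) :
  algebraic_lattice (sigma P).
Proof.
split; first exact: sigma_complete.
move=> U; split; first exact: directed_compact_below.
split=> [V [] //|W ubW]; apply/sigma_leP => x Ux.
have [K [oK Kx KU KK]] := finitary_basis P_countable (sigma_open U) Ux.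
have [K' eK] := sigma_witness oK; rewrite -eK in Kx KU KK.
suff /sigma_leP : K' <= W by apply.
by apply: ubW; split; [exact: inside_compact|exact/sigma_leP].
Qed.
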